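(* Let $\mathcal C$ be a fractionally $\mathsf{tree}\text{-}\alpha$-fragile graph class. Suppose that its fragility function $f$ satisfies $f(r)\le c\,r^a$ for some constants $c\ge 1$ and $a\ge 0$ and every $r\in\mathbb N$. Then there exists a constant $C=C_{c,a}$ (depending only on $c$ and $a$) such that every $n$-vertex graph $G\in\mathcal C$ satisfies $$\mathsf{sep}\text{-}\alpha(G)\le C\,n^{a/(a+1)}.$$
   Context: All graphs are finite, simple and (unless stated otherwise) nonempty; $\mathbb N$ is the set of positive integers; $\alpha$ denotes independence number. A balanced separator of $G$ is a set $S\subseteq V(G)$ such that every connected component of $G-S$ has at most $2|V(G)|/3$ vertices; $\mathsf{sep}\text{-}\alpha(G)$ is the minimum of $\alpha(G[S])$ over all balanced separators $S$ of $G$. The tree-independence number $\mathsf{tree}\text{-}\alpha(G)$ is the minimum over all tree decompositions of $G$ of the maximum of $\alpha(G[X])$ over all bags $X$. For $0\le\beta\le 1$, a $\beta$-general cover of $G$ is a nonempty finite multiset $\mathcal A$ of subsets of $V(G)$ such that each vertex belongs to at least $\beta|\mathcal A|$ elements of $\mathcal A$ (counted with multiplicity); its $\mathsf{tree}\text{-}\alpha$-width is $\max_{A\in\mathcal A}\mathsf{tree}\text{-}\alpha(G[A])$ (the empty graph contributes value $0$). A graph class $\mathcal C$ is fractionally $\mathsf{tree}\text{-}\alpha$-fragile with fragility function $f\colon\mathbb N\to\mathbb N$ if, for every $r\in\mathbb N$, every $G\in\mathcal C$ has a $(1-1/r)$-general cover with $\mathsf{tree}\text{-}\alpha$-width at most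 $f(r)$. *)

(* Defs.v *)
From HB Require Import structures.
From mathcomp Require Import all_boot all_order all_algebra.
From mathcomp Require Import boolp reals.
Set Implicit Arguments.
Unset Strict Implicit.
Unset Printing Implicit Defensive.
Import Order.TTheory GRing.Theory Num.Theory.

(* A finite simple graph, possibly empty: the graphs G[A] below need the empty
   case. *)
Record sgraph := SGraph {
  svertex :> finType;
  sedge : rel svertex;
  sedge_sym : symmetric sedge;
  sedge_irrefl : irreflexive sedge
}.

Section Induced.
Variables (G : sgraph) (A : {set G}).

Definition induced_edge : rel {x : G | x \in A} :=
  fun x y => sedge (val x) (val y).

Lemma induced_sym : symmetric induced_edge.
Proof. by move=> x y; apply: sedge_sym. Qed.

Lemma induced_irrefl : irreflexive induced_edge.
Proof. by move=> x; apply: sedge_irrefl. Qed.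

Definition induced : sgraph := SGraph induced_sym induced_irrefl.
End Induced.

Definition stable (G : sgraph) (S : {set G}) : bool :=
  [forall x in S, forall y in S, ~~ sedge x y].

Definition alpha (G : sgraph) : nat := \max_(S : {set G} | stable S) #|S|.

Definition connected_graph (G : sgraph) : Prop :=
  forall x y : G, connect (@sedge G) x y.

Definition components (G : sgraph) : {set {set G}} :=
  [set [set y | connect (@sedge G) x y] | x : G].

(* The cross-multiplied form of #|K| <= 2 #|G| / 3, for K a component of
   G - S. *)
Definition balanced_separator (G : sgraph) (S : {set G}) : bool :=
  [forall K in components (induced (~: S)), 3 * #|K| <= 2 * #|G|].

Lemma sep_alpha_ex (G : sgraph) :
  exists k, [exists S : {set G}, balanced_separator S && (alpha (induced S) == k)].
Proof.
exists (alpha (induced [set: G])); apply/existsP; exists [set: G].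
rewrite eqxx andbT; apply/forall_inP => K /imsetP[[x xP] _ _].
by have := xP; rewrite !inE.
Qed.

Definition sep_alpha (G : sgraph) : nat := ex_minn (sep_alpha_ex G).

(* In [ucycle] a single edge counts as a cycle with two vertices. *)
Definition is_tree (T : sgraph) : Prop :=
  [/\ 0 < #|T|, connected_graph T
    & forall p : seq T, ucycle (@sedge T) p -> size p < 3].

Record tree_decomp (G : sgraph) := TreeDecomp {
  td_tree : sgraph;
  td_bag : td_tree -> {set G};
  td_is_tree : is_tree td_tree;
  td_vertex : forall v : G, exists t, v \in td_bag t;
  td_edge : forall u v : G, sedge u v ->
    exists t, (u \in td_bag t) && (v \in td_bag t);
  td_connected : forall v : G,
    connected_graph (induced [set t | v \in td_bag t])
}.

Definition td_width (G : sgraph) (D : tree_decomp G) : nat :=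
  \max_(t : td_tree D) alpha (induced (td_bag t)).

Section TrivialDecomposition.
Variable G : sgraph.

Definition point_graph : sgraph :=
  @SGraph unit (fun _ _ => false) (fun _ _ => erefl) (fun _ => erefl).

Lemma point_graph_tree : is_tree point_graph.
Proof.
split; first by rewrite card_unit.
- by move=> [] []; apply: connect0.
- move=> p /andP[_ /card_uniqP <-].
  by apply: leq_ltn_trans (max_card _) _; rewrite card_unit.
Qed.

Definition trivial_bag (_ : point_graph) : {set G} := [set: G].

Lemma trivial_vertex (v : G) : exists t, v \in trivial_bag t.
Proof. by exists tt; rewrite inE. Qed.

Lemma trivial_edge (u v : G) : sedge u v ->
  exists t, (u \in trivial_bag t) && (v \in trivial_bag t).
Proof. by exists tt; rewrite !inE. Qed.

Lemma trivial_connected (v : G) :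
  connected_graph (induced [set t | v \in trivial_bag t]).
Proof.
move=> [[] p] [[] q]; rewrite (_ : exist _ tt p = exist _ tt q) ?connect0 //.
exact: val_inj.
Qed.

Definition trivial_decomp : tree_decomp G :=
  TreeDecomp point_graph_tree trivial_vertex trivial_edge trivial_connected.
End TrivialDecomposition.

Lemma tree_alpha_ex (G : sgraph) :
  exists k, `[< exists D : tree_decomp G, td_width D = k >].
Proof.
by exists (td_width (trivial_decomp G)); apply/asboolP; exists (trivial_decomp G).
Qed.

Definition tree_alpha (G : sgraph) : nat := ex_minn (tree_alpha_ex G).

(* The multiset is given as a list; only multiplicities matter. *)
Definition general_cover (R : realType) (G : sgraph) (beta : R)
    (A : seq {set G}) : Prop :=
  0 < size A /\
  forall v : G,
    (beta * (size A)%:R <= (count (fun X : {set G} => v \in X) A)%:R)%R.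

Definition cover_tree_alpha_width (G : sgraph) (A : seq {set G}) : nat :=
  \max_(X <- A) tree_alpha (induced X).

(* [f] stands for a map from positive integers to positive integers, so its
   value at 0 is irrelevant. *)
Definition fractionally_tree_alpha_fragile (R : realType)
    (C : sgraph -> Prop) (f : nat -> nat) : Prop :=
  (forall r, 0 < r -> 0 < f r) /\
  forall r, 0 < r -> forall G : sgraph, C G ->
    exists A : seq {set G},
      general_cover (1 - r%:R^-1 : R)%R A /\ cover_tree_alpha_width A <= f r.

(* Main.v *)
Require Import Defs.
From HB Require Import structures.
From mathcomp Require Import all_boot all_order all_algebra.
From mathcomp Require Import boolp reals exp.
From mathcomp Require Import zify lra.
Set Implicit Arguments.
Unset Strict Implicit.
Unset Printing Implicit Defensive.
Import Order.TTheory GRing.Theory Num.Theory.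

(** A cover of fragility parameter [r] contains, by averaging, a set [A] that
    misses at most [n / r] vertices ([general_cover_large_member]).  Take an
    optimal tree decomposition of [G[A]].  As in the classical treewidth
    argument, one of its bags [X] is a balanced separator of [G[A]]
    ([tree_decomp_centroid]): otherwise every node of the tree points to the
    neighbour in whose direction more than half of the vertices lie, two
    adjacent nodes must point to each other because the tree has no cycle, and
    the two majorities would be disjoint.  The union of [X] with the complement
    of [A] then separates [G], and its independence number is at most
    [f r + n / r] ([sep_alpha_le_tree_alpha]).

    With [f r <= c r^a], the two terms are balanced by choosing [r] of order
    [n^(1/(a+1))], so both become of order [n^(a/(a+1))]. *)

(** * Walks that avoid a set of vertices *)

Section Avoiding.
Variables (G : sgraph) (X : {set G}).

(** Deleting [X] while keeping the same vertex type avoids iterating subtypes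
    when [G] is itself an induced subgraph. *)
Definition avoiding : rel G :=
  fun x y => [&& sedge x y, x \notin X & y \notin X].

Lemma connect_avoidingC : connect_sym avoiding.
Proof.
apply: sym_connect_sym => x y.
by rewrite /avoiding sedge_sym [(x \notin X) && _]andbC.
Qed.

End Avoiding.

Lemma connect_homo (T T' : finType) (e : rel T) (e' : rel T') (h : T -> T') :
  {homo h : x y / e x y >-> e' x y} ->
  {homo h : x y / connect e x y >-> connect e' x y}.
Proof.
move=> he x y /connectP[p pth ->]; apply/connectP; exists (map h p).
  by elim: p x pth => //= z p IHp x /andP[/he -> /IHp].
by rewrite last_map.
Qed.

(** * Trees *)

Section Trees.
Variables (T : sgraph) (treeT : is_tree T).

(** The first step of a simple path from [t] to [u] leads to [s]; the rest of the
    path never returns to [t]. *)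
Lemma tree_branch (t u : T) : u != t ->
  exists2 s, sedge t s & connect (avoiding [set t]) s u.
Proof.
case: treeT => _ /(_ t u)/connectP[p0 pth0 uE] _; move: uE.
case/shortenP: pth0 => -[|s q] /=; first by move=> _ _ _ ->; rewrite eqxx.
case/andP=> ts qpth /andP[tsq _] _ uE _; exists s => //.
apply/connectP; exists q => //.
elim: q s tsq qpth {ts uE} => //= z q IHq s.
rewrite !inE !negb_or => /and3P[ts tz tq] /andP[sz zpth].
by rewrite /avoiding sz !inE eq_sym ts eq_sym tz IHq // inE negb_or tz.
Qed.

(** A node [u] on both sides would give a walk from [s] to [t] that does not
    use the edge [ts]; made simple, it closes up with that edge to a cycle. *)
Lemma tree_edge_sides_disjoint (t s u : T) : sedge t s ->
  connect (avoiding [set t]) s u -> ~~ connect (avoiding [set s]) t u.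
Proof.
move=> ts su; apply/negP => tu.
pose e := [rel x y : T | [&& sedge x y, ~~ ((x == s) && (y == t))
                         & ~~ ((x == t) && (y == s))]].
have sub r : r \in [:: s; t] ->
    {homo @id T : x y / avoiding [set r] x y >-> e x y}.
  rewrite !inE => rst x y /and3P[xy]; rewrite !inE /= xy.
  by case/orP: rst => /eqP-> /negPf-> /negPf->; rewrite ?andbF.
have: connect e s t.
  apply: (@connect_trans _ _ u).
    by apply: (connect_homo (sub t _)) su; rewrite !inE eqxx orbT.
  apply: (connect_homo (sub s _)); first by rewrite !inE eqxx.
  by rewrite connect_avoidingC.
case/connectP=> p0 pth0 tE; move: tE.
case/shortenP: pth0 => p pth uniqp _ tE.
have es : subrel e (@sedge T) by move=> x y /and3P[].
case: treeT => _ _ /(_ (s :: p)).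
case: p pth uniqp tE => [|x [|y p]] pth uniqp tE.
- by move: ts; rewrite tE sedge_irrefl.
- by move: pth; rewrite -[x]tE /= !eqxx /= !andbF.
- move=> acyclic; suff /acyclic : ucycle (@sedge T) [:: s, x, y & p] by [].
  rewrite /ucycle uniqp andbT (cycle_path s) /=.
  by move: (sub_path es pth) ts; rewrite /= tE => -> ->.
Qed.

(** The orbit of any node ends in a cycle of [g]; as a closed walk with
    distinct nodes, it can only have length two. *)
Lemma tree_pointer_backtracks (g : T -> T) :
  (forall t, sedge t (g t)) -> exists t, g (g t) = t.
Proof.
move=> gE; case: (treeT) => /card_gt0P[x _] _ acyclic.
have /trajectP[i i_lt iE] := looping_order g x.
pose y := iter i g x; pose p := order g x - i.
have p_gt0 : 0 < p by rewrite subn_gt0.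
have yE : iter p g y = y by rewrite /y -iterD subnK 1?ltnW.
have uniqp : uniq (traject g y p).
  move: (orbit_uniq g x); rewrite /orbit -{1}(subnKC (ltnW i_lt)) -/p.
  by rewrite trajectD cat_uniq => /and3P[].
have cyc : cycle (@sedge T) (traject g y p).
  case: p p_gt0 yE {uniqp} => // p _ yE.
  rewrite trajectS /= -[in X in rcons _ X]yE iterSr -trajectSr.
  have es : subrel (frel g) (@sedge T) by move=> z _ /eqP <-.
  exact: sub_path es _ _ (fpath_traject _ _ _).
have := acyclic (traject g y p); rewrite size_traject /ucycle cyc uniqp.
move/(_ isT).
case: p p_gt0 yE {uniqp cyc} => [|[|[|]]] //= _ yE _; last by exists y.
by have := gE y; rewrite yE sedge_irrefl.
Qed.

End Trees.

(** * A bag that is a balanced separator *)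

Section Centroid.
Variables (G : sgraph) (D : tree_decomp G).

Lemma bag_nodes_connected (v : G) (t u w : td_tree D) :
  v \notin td_bag t -> v \in td_bag u -> v \in td_bag w ->
  connect (avoiding [set t]) u w.
Proof.
move=> vt vu vw.
have uP : u \in [set t | v \in td_bag t] by rewrite inE.
have wP : w \in [set t | v \in td_bag t] by rewrite inE.
have := @td_connected _ D v (exist _ u uP) (exist _ w wP).
apply: (@connect_homo _ _ _ _ val) => -[y yP] [z zP] yz.
have [vy vz] : v \in td_bag y /\ v \in td_bag z.
  by split; [have := yP | have := zP]; rewrite inE.
by apply/and3P; split=> //; rewrite inE; apply: contraNneq vt => <-.
Qed.

(** A connected set of vertices missing the bag at [t] occupies a connected set
    of nodes other than [t], which lies beyond one neighbour of [t]. *)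
Lemma component_branch (t : td_tree D) (x : G) : x \notin td_bag t ->
  exists2 s, sedge t s &
    forall y, connect (avoiding (td_bag t)) x y ->
    forall u, y \in td_bag u -> connect (avoiding [set t]) s u.
Proof.
move=> xt; have [u0 xu0] := td_vertex D x.
have u0t : u0 != t by apply: contraNneq xt => <-.
have [s ts su0] := tree_branch (td_is_tree D) u0t.
exists s => // y /connectP[p pth ->].
have: forall u, x \in td_bag u -> connect (avoiding [set t]) s u.
  by move=> u xu; apply: connect_trans su0 (bag_nodes_connected xt xu0 xu).
elim: p x pth {xt u0 xu0 u0t su0} => //= z p IHp x /andP[/and3P[xz xt zt] pth].
move=> sx; apply: IHp pth _ => u zu.
have [w /andP[xw zw]] := td_edge D xz.
exact: connect_trans (sx w xw) (bag_nodes_connected zt zw zu).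
Qed.

(** If every bag left a component with a majority of the vertices, each node
    would point to the branch holding that component.  Two adjacent nodes
    pointing to each other have disjoint majorities, since a common vertex would
    have its nodes on both sides of one edge. *)
Lemma tree_decomp_centroid :
  exists t : td_tree D, forall x, x \notin td_bag t ->
    2 * #|[set y | connect (avoiding (td_bag t)) x y]| <= #|G|.
Proof.
pose K (t : td_tree D) x := [set y | connect (avoiding (td_bag t)) x y].
apply: contrapT => noC.
have /fin_all_exists[g gP] (t : td_tree D) : exists s, sedge t s /\
    exists x, #|G| < 2 * #|K t x| /\
      forall y, y \in K t x -> forall u, y \in td_bag u ->
        connect (avoiding [set t]) s u.
  apply: contrapT => noS; apply: noC; exists t => x xt.
  rewrite leqNgt; apply/negP => big; apply: noS.
  have [s ts sP] := component_branch xt; exists s; split=> //.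
  by exists x; split=> // y; rewrite inE; apply: sP.
have [t ggt] := tree_pointer_backtracks (td_is_tree D) (fun t => (gP t).1).
have [ts [x [bigx xP]]] := gP t; have [_ [z [bigz]]] := gP (g t).
rewrite ggt => zP.
suff: [disjoint K t x & K (g t) z].
  rewrite -leq_card_setU => /eqP cardU.
  have := max_card (K t x :|: K (g t) z); rewrite cardU; lia.
apply/pred0P => y /=; apply/negP => /andP[yx yz].
have [u yu] := td_vertex D y.
have /negP[] := tree_edge_sides_disjoint (td_is_tree D) ts (xP y yx u yu).
exact: zP yu.
Qed.

End Centroid.

(** * Separating a graph along an induced subgraph *)

Section SeparateAlong.
Variables (G : sgraph) (A : {set G}).

(** A stable set splits into its part inside [X] and its part outside [A];
    the latter is bounded by its mere size. *)
Lemma alpha_lift_setC (X : {set induced A}) :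
  alpha (induced (val @: X :|: ~: A)) <= alpha (induced X) + #|~: A|.
Proof.
set S := _ :|: _; rewrite {1}/alpha; apply/bigmax_leqP => I /forall_inP stI.
pose J : {set induced X} :=
  [set h | val (val h) \in (val : induced S -> G) @: I].
have stJ : stable J.
  apply/forall_inP => h; rewrite inE => /imsetP[x xI hE].
  apply/forall_inP => k; rewrite inE => /imsetP[y yI kE].
  by have /forall_inP/(_ y yI) := stI x xI; rewrite /= /induced_edge hE kE.
have JX : #|J| <= alpha (induced X) by apply: (leq_bigmax_cond _ stJ).
apply: leq_trans (leq_add JX (leqnn _)).
rewrite -(card_imset (mem I) val_inj).
rewrite -(card_imset (mem J) (inj_comp val_inj val_inj)).
apply: leq_trans (leq_card_setU _ _); apply/subset_leq_card/subsetP => v vI.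
rewrite inE; case/imsetP: (vI) => -[w wS] wI vE; rewrite vE /= in vI *.
case/setUP: (wS) => [/imsetP[h hX wE]|->]; last by rewrite orbT.
rewrite wE; apply/orP; left; apply/imsetP.
by exists (exist _ h hX) => //; rewrite inE /= -wE.
Qed.

(** Every component of [G - (X :|: ~: A)] lies in [A], hence inside a component
    of [G[A] - X]; that component has at most [#|A| / 2] vertices, within the
    allowed two thirds of [#|G|]. *)
Lemma balanced_lift_setC (X : {set induced A}) :
  (forall x, x \notin X ->
     2 * #|[set y | connect (avoiding X) x y]| <= #|induced A|) ->
  balanced_separator (val @: X :|: ~: A).
Proof.
set S := _ :|: _ => balX.
apply/forall_inP => _ /imsetP[x _ ->].
have inA (y : induced (~: S)) : val y \in A.
  by have := valP y; rewrite !inE negb_or negbK => /andP[].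
pose h y : induced A := exist _ (val y) (inA y).
have hX y : h y \notin X.
  have := valP y; rewrite !inE negb_or => /andP[+ _].
  by apply: contra => hyX; apply/imsetP; exists (h y).
have h_inj : injective h by move=> y z /(congr1 val) /= /val_inj.
rewrite -(card_imset _ h_inj).
have sub : h @: [set y | connect (@sedge (induced (~: S))) x y] \subset
           [set y | connect (avoiding X) (h x) y].
  apply/subsetP => _ /imsetP[y + ->]; rewrite !inE.
  by apply: connect_homo => u v uv; rewrite /avoiding !hX !andbT.
have cardA : #|induced A| <= #|G| by rewrite /= card_sig max_card.
have := leq_trans (leq_mul (leqnn 2) (subset_leq_card sub)) (balX _ (hX x)).
move/leq_trans/(_ cardA); set k := #|_ @: _|; set n := #|G|; lia.
Qed.

Lemma sep_alpha_le_tree_alpha : sep_alpha G <= tree_alpha (induced A) + #|~: A|.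
Proof.
rewrite /tree_alpha; case: ex_minnP => _ /asboolP[D <-] _.
have [t balt] := tree_decomp_centroid D.
rewrite /sep_alpha; case: ex_minnP => k _ kmin.
apply: leq_trans (leq_trans (alpha_lift_setC (td_bag t)) _).
  apply: kmin; apply/existsP; exists (val @: td_bag t :|: ~: A).
  by rewrite eqxx andbT balanced_lift_setC.
by rewrite leq_add2r; apply: (leq_bigmax_cond (F := fun t => alpha _)).
Qed.

End SeparateAlong.

(** * Averaging over a cover and optimising the parameter *)

Local Open Scope ring_scope.

(** Each vertex is missed by at most a fraction [1 / r] of the cover, so the
    members of the cover miss at most [#|G| / r] vertices on average. *)
Lemma general_cover_large_member (R : realType) (G : sgraph) (r : nat)
    (A : seq {set G}) : (0 < r)%N -> general_cover (1 - r%:R^-1 : R) A ->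
  exists2 X, X \in A & (r * #|~: X| <= #|G|)%N.
Proof.
move=> r_gt0 [A_gt0 covA]; apply/hasP; apply: contraLR A_gt0 => /hasPn missA.
rewrite -leqNgt leqn0.
have missE : (\sum_(X <- A) #|~: X| =
    \sum_(v : G) count (fun X : {set G} => v \notin X) A)%N.
  under eq_bigr do rewrite -sum1_card.
  under [RHS]eq_bigr do rewrite -sum1_count.
  rewrite [RHS](exchange_big_dep predT) //=.
  apply: eq_bigr => X _; rewrite [RHS]big_mkcond [LHS]big_mkcond /=.
  by apply: eq_bigr => v _; rewrite inE.
have missv (v : G) : (r * count (fun X : {set G} => v \notin X) A <= size A)%N.
  have r0 : 0 < r%:R :> R by rewrite ltr0n.
  have := covA v; rewrite -(ler_pM2l r0) mulrA mulrBr mulr1 divff ?gt_eqF //.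
  rewrite mulrBl mul1r lerBlDr -!natrM -natrD ler_nat.
  rewrite -(count_predC (fun X : {set G} => v \in X) A).
  rewrite mulnDr leq_add2l; exact: leq_trans.
have le_total : (r * \sum_(X <- A) #|~: X| <= #|G| * size A)%N.
  rewrite missE big_distrr /= -sum_nat_const.
  exact: leq_sum.
have : (\sum_(X <- A) (#|G|).+1 <= r * \sum_(X <- A) #|~: X|)%N.
  rewrite big_distrr /= !big_seq; apply: leq_sum => X /missA.
  by rewrite -ltnNge.
rewrite big_const_seq count_predT iter_addn_0; nia.
Qed.

Lemma sep_alpha_le_fragility (R : realType) (C : sgraph -> Prop)
    (f : nat -> nat) (r : nat) (G : sgraph) :
  fractionally_tree_alpha_fragile R C f -> (0 < r)%N -> C G ->
  exists2 m, (sep_alpha G <= f r + m)%N & (r * m <= #|G|)%N.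
Proof.
case=> _ fragC r_gt0 CG; have [A [covA widthA]] := fragC r r_gt0 G CG.
have [X XA Xlarge] := general_cover_large_member r_gt0 covA.
exists #|~: X| => //; apply: leq_trans (sep_alpha_le_tree_alpha X) _.
rewrite leq_add2r; apply: leq_trans widthA.
exact: (leq_bigmax_seq (F := fun X => tree_alpha (induced X)) X XA isT).
Qed.

Theorem corollary6p2 (R : realType) (c a : R) (c_ge1 : 1 <= c) (a_ge0 : 0 <= a) :
  exists K : R,
    forall (C : sgraph -> Prop) (f : nat -> nat),
      (forall G : sgraph, C G -> (0 < #|G|)%N) ->
      fractionally_tree_alpha_fragile R C f ->
      (forall r : nat, (0 < r)%N -> (f r)%:R <= c * r%:R `^ a) ->
      forall (n : nat) (G : sgraph), C G -> #|G| = n ->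
        (sep_alpha G)%:R <= K * n%:R `^ (a / (a + 1)).
Proof.
exists (c * 2 `^ a + 1) => C f C_gt0 fragC f_le n G CG nE.
have n_ge1 : 1 <= n%:R :> R by rewrite ler1n -nE C_gt0.
have a1 : a + 1 != 0 by rewrite gt_eqF //; lra.
(* [q ^ a] and [n / q] agree, so [r] is taken between [q] and [2 q]; the
   factor [2 ^ a] in the constant pays for this rounding. *)
pose q : R := n%:R `^ (a + 1)^-1.
have q_ge1 : 1 <= q.
  rewrite -(powRr0 n%:R); apply: ler_powR => //; rewrite invr_ge0; lra.
have q_gt0 : 0 < q by lra.
have qa : q `^ a = n%:R `^ (a / (a + 1)) by rewrite -powRrM mulrC.
have qn : q * q `^ a = n%:R.
  rewrite -{1}(powRr1 (ltW q_gt0)) -powRD ?(gt_eqF q_gt0) ?implybT //.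
  by rewrite -powRrM [1 + a]addrC mulVf // powRr1 // ler0n.
pose r := (Num.truncn q).+1.
have r_gt : q < r%:R by apply: truncnS_gt.
have r_le : r%:R <= 2 * q.
  have : (Num.truncn q)%:R <= q by rewrite truncn_le ltW.
  rewrite /r -natr1; lra.
have [m sep_le rm_le] := sep_alpha_le_fragility fragC (ltn0Sn _ : 0 < r)%N CG.
rewrite -qa.
have fr : (f r)%:R <= c * 2 `^ a * q `^ a.
  apply: le_trans (f_le r isT) _; rewrite -mulrA -powRM ?ler0n ?(ltW q_gt0) //.
  by rewrite ler_wpM2l ?ge0_ler_powR ?nnegrE ?ler0n ?mulr_ge0 ?(ltW q_gt0) //; lra.
have mq : m%:R <= q `^ a.
  rewrite -(ler_pM2l q_gt0) qn.
  apply: le_trans (_ : r%:R * m%:R <= _); last by rewrite -natrM ler_nat -nE.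
  by rewrite ler_wpM2r ?ler0n // ltW.
have : (sep_alpha G)%:R <= (f r)%:R + m%:R :> R by rewrite -natrD ler_nat.
by rewrite mulrDl mul1r; lra.
Qed.
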